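(* Let $\lambda$ be a signature with $N$ parts. Take complex parameters $s^{-2}\mathbf x^{-1}=(s^{-2}x_1^{-1},\ldots,s^{-2}x_N^{-1})$, $-\mathbf y^{-1}=(-y_1^{-1},-y_2^{-1},\ldots)$, $\mathbf r=(r,\ldots,r)$, $\mathbf s=(s,s,\ldots)$. Then $$\lim_{s\to0,\ r\to+\infty}F_\lambda(s^{-2}\mathbf x^{-1};-\mathbf y^{-1};\mathbf r;\mathbf s)=\frac{x_1^{N-1}x_2^{N-2}\cdots x_{N-1}}{\prod_{i\ge1}y_i^{\#\{k\in\mathcal S(\lambda):k>i\}}}\,s_\lambda(\mathbf x\mid\mathbf y),$$ where $s_\lambda(\mathbf x\mid\mathbf y)$ is the factorial Schur polynomial $$s_\lambda(\mathbf x\mid\mathbf y)=\frac{\det\left[(x_i\mid\mathbf y)^{\lambda_j+N-j}\right]_{i,j=1}^N}{\prod_{1\le i<j\le N}(x_i-x_j)},\qquad(x\mid\mathbf y)^k=(x+y_1)\cdots(x+y_k).$$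
   Context: A signature with $N$ parts is an integer sequence $\lambda=(\lambda_1\ge\ldots\ge\lambda_N\ge0)$; $\mathcal S(\lambda)=\{\lambda_j+N+1-j:1\le j\le N\}\subset\mathbb Z_{\ge1}$. The function $F_\lambda$. For $i_1,j_1,i_2,j_2\in\{0,1\}$ (numbers of paths entering from the bottom, entering from the left, exiting at the top, exiting to the right) put $\widehat W(\cdot)=\widehat W(\cdot\mid x;y;r;s)$ with $\widehat W(0,0;0,0)=\frac{s^{-2}y-x}{y-x}$, $\widehat W(1,1;1,1)=\frac{r^{-2}x-y}{y-x}$, $\widehat W(1,0;1,0)=\frac{s^{-2}y-r^{-2}x}{y-x}$, $\widehat W(0,1;0,1)=1$, $\widehat W(1,0;0,1)=\frac{x(r^{-2}-1)}{y-x}$, $\widehat W(0,1;1,0)=\frac{y(s^{-2}-1)}{y-x}$, and $\widehat W=0$ otherwise. A configuration on $\mathbb Z_{\ge1}\times\{1,\ldots,N\}$ consists of vertical edge states $v(i,j)\in\{0,1\}$ ($i\ge1$, $0\le j\le N$; $v(i,j-1)$ below and $v(i,j)$ above the vertex $(i,j)$) and horizontal edge states $h(i,j)\in\{0,1\}$ ($i\ge0$, $1\le j\le N$; $h(i-1,j)$ to the left and $h(i,j)$ to the right of $(i,j)$). For $\lambda$ with $N$ parts, $F_\lambda(x_1,\ldots,x_N;\mathbf y;r_1,\ldots,r_N;\mathbf s)$ is the sum over configurations with $v(i,0)=\mathbf 1_{i\in\mathcal S(\lambda)}$, $v(i,N)=0$, $h(0,j)=0$, $h(i,j)=1$ for all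 large $i$, of $\prod_{i\ge1}\prod_{j=1}^N\widehat W(v(i,j-1),h(i-1,j);v(i,j),h(i,j)\mid x_j;y_i;r_j;s_i)$ (finitely many nonzero terms, each with all but finitely many factors equal to $1$). The $x_i$, $y_i$ are nonzero; the ratio defining $s_\lambda(\mathbf x\mid\mathbf y)$ is a polynomial. *)

(* Defs.v *)
From HB Require Import structures.
From mathcomp Require Import all_boot all_order all_algebra finmap.
From mathcomp Require Import all_classical all_reals topology normedtype sequences.
From mathcomp Require Import complex.
(* The notations of mpoly are incompatible with those of mathcomp-analysis. *)
From mathcomp Require Import -(notations) mpoly.

Set Implicit Arguments.
Unset Strict Implicit.
Unset Printing Implicit Defensive.

Import Order.TTheory GRing.Theory Num.Theory.
Import numFieldNormedType.Exports.

Local Open Scope classical_set_scope.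
Local Open Scope ring_scope.

(* R[i] itself is not a canonical topological space; as an element of
   numClosedFieldType it carries the topology of the complex modulus. *)
Definition Cplx (R : realType) : numClosedFieldType := R[i].

Definition signature (N : nat) (lam : N.-tuple nat) : bool := sorted geq lam.

(* Here j : 'I_N stands for the 1-based index j + 1,
   hence lambda_j + N + 1 - j becomes lam_j + (N - j). *)
Definition positions (N : nat) (lam : N.-tuple nat) : {fset nat} :=
  [fset (tnth lam j + (N - j))%N | j in 'I_N]%fset.

Definition positions_above (N : nat) (lam : N.-tuple nat) (i : nat) : nat :=
  #|` [fset k in positions lam | (i < k)%N]%fset |.

Section PartitionFunction.
Variable K : numFieldType.

(* (i1, j1; i2, j2): bottom, left; top, right *)
Definition What (i1 j1 i2 j2 : bool) (x y r s : K) : K :=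
  match i1, j1, i2, j2 with
  | false, false, false, false => (s ^- 2 * y - x) / (y - x)
  | true, true, true, true => (r ^- 2 * x - y) / (y - x)
  | true, false, true, false => (s ^- 2 * y - r ^- 2 * x) / (y - x)
  | false, true, false, true => 1
  | true, false, false, true => x * (r ^- 2 - 1) / (y - x)
  | false, true, true, false => y * (s ^- 2 - 1) / (y - x)
  | _, _, _, _ => 0
  end.

Variable N : nat.

(* For c : configuration, c.1 i j is the state v(i + 1, j) of a vertical edge,
   and c.2 i j is the state h(i, j + 1) of a horizontal edge, so that
   the edges around the vertex (i + 1, j + 1) are: c.1 i j below,
   c.1 i (j + 1) above, c.2 i j on the left and c.2 (i + 1) j on the right. *)
Definition configuration : choiceType :=
  ((nat -> 'I_N.+1 -> bool) * (nat -> 'I_N -> bool))%type.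

Definition boundary (lam : N.-tuple nat) : set configuration :=
  [set c | [/\ forall i, c.1 i ord0 = (i.+1 \in positions lam),
               forall i, c.1 i ord_max = false,
               forall j, c.2 0%N j = false
             & \forall i \near \oo, forall j, c.2 i j = true]].

(* The partial products over columns are eventually constant for every c in
   boundary lam: far enough to the right, a column has either all its weights
   equal to 1 or a weight equal to 0 for want of path conservation. *)
Definition weight (x : 'I_N -> K) (y : nat -> K) (r : 'I_N -> K) (s : nat -> K)
    (c : configuration) : K :=
  limn (fun n => \prod_(0 <= i < n) \prod_(j < N)
    What (c.1 i (widen_ord (leqnSn N) j)) (c.2 i j)
         (c.1 i (lift ord0 j)) (c.2 i.+1 j)
         (x j) (y i.+1) (r j) (s i.+1) : K).

(* The sequences y and s are indexed from 1; y 0 and s 0 are not used.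
   The sum \sum_(c \in _) ranges over the finitely many nonzero terms. *)
Definition F (lam : N.-tuple nat)
    (x : 'I_N -> K) (y : nat -> K) (r : 'I_N -> K) (s : nat -> K) : K :=
  \sum_(c \in boundary lam) weight x y r s c.

End PartitionFunction.

(* (x | y)^k, with y indexed from 1 *)
Definition shifted_pow (A : comNzRingType) (x : A) (y : nat -> A) (k : nat) : A :=
  \prod_(1 <= l < k.+1) (x + y l).

Definition alternant (A : comNzRingType) (N : nat) (lam : N.-tuple nat)
    (x : 'I_N -> A) (y : nat -> A) : A :=
  \det (\matrix_(i < N, j < N) shifted_pow (x i) y (tnth lam j + (N - j.+1))).

Definition vandermonde_prod (A : comNzRingType) (N : nat) (x : 'I_N -> A) : A :=
  \prod_(i < N) \prod_(j < N | (i < j)%N) (x i - x j).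

Lemma newton_interpolation (A : comNzRingType) (n : nat) (a : 'I_n -> A)
    (f : {poly A}) :
  exists d : 'I_n -> A, forall i,
    f.[a i] = \sum_(k < n) (\prod_(l < n | (k < l)%N) (a i - a l)) * d k.
Proof.
have main t : (t <= n)%N -> exists (d : 'I_n -> A) (g : {poly A}),
    f = \sum_(k < n | (n - t <= k)%N)
          (\prod_(l < n | (k < l)%N) ('X - (a l)%:P)) * (d k)%:P
        + g * \prod_(l < n | (n - t <= l)%N) ('X - (a l)%:P).
  elim: t => [_|t IH tn].
    exists (fun=> 0), f; rewrite subn0 !big_pred0 ?add0r ?mulr1 // => k;
    by rewrite leqNgt ltn_ord.
  have [d [g fE]] := IH (ltnW tn).
  have mn : (n - t.+1 < n)%N by rewrite ltn_subrL (leq_ltn_trans _ tn).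
  pose m := Ordinal mn.
  have ntE : (n - t = m.+1)%N by rewrite /= -subSn // subSS.
  have : root (g - g.[a m]%:P) (a m) by rewrite rootE hornerD hornerN hornerC subrr.
  move=> /factor_theorem[q /eqP]; rewrite subr_eq => /eqP gE.
  exists (fun k => if k == m then g.[a m] else d k), q.
  rewrite {1}fE ntE {1}gE mulrDl -mulrA.
  rewrite [in RHS](bigD1 m) //= eqxx.
  rewrite [X in _ = _ + q * X](bigD1 m) //=.
  have split_m (l : 'I_n) : (n - t.+1 <= l)%N && (l != m) = (n - t.+1 < l)%N.
    by rewrite ltn_neqAle andbC eq_sym.
  rewrite (eq_bigl _ _ split_m) (eq_bigl _ _ split_m).
  rewrite [_ * g.[_]%:P]mulrC -[RHS]addrA [LHS]addrA [LHS]addrC.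
  congr (_ + (_ + _)).
  apply: eq_bigr => k mk; case: eqP => [km|//].
  by move: mk; rewrite km /= ltnn.
have [d [g fE]] := main n (leqnn n).
exists d => i; rewrite {1}fE hornerD hornerM horner_prod horner_sum.
rewrite [X in _ + _ * X](bigD1 i) ?subnn //= hornerXsubC subrr mul0r mulr0 addr0.
apply: eq_big => [k|k _]; first by rewrite leq0n.
rewrite hornerM horner_prod hornerC; congr (_ * _).
by apply: eq_bigr => l _; rewrite hornerXsubC.
Qed.

Lemma vandermonde_dvd_det (A : comNzRingType) (n : nat) (a : 'I_n -> A)
    (f : 'I_n -> {poly A}) :
  exists q, q * vandermonde_prod a = \det (\matrix_(i, j) (f j).[a i]).
Proof.
have /boolp.choice[d dE] := fun j => newton_interpolation a (f j).
pose L := \matrix_(k < n, i < n) \prod_(l < n | (k < l)%N) (a i - a l).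
exists (\det (\matrix_(k, j) d j k)).
have -> : vandermonde_prod a = \det L^T.
  rewrite det_tr det_trig; first by apply: eq_bigr => i _; rewrite mxE.
  apply/is_trig_mxP => k i ki; rewrite mxE (bigD1 i) //= subrr mul0r //.
rewrite mulrC -det_mulmx; congr (\det _).
apply/matrixP => i j; rewrite !mxE dE.
by apply: eq_bigr => k _; rewrite !mxE.
Qed.

Section FactorialSchur.
Variables (K : fieldType) (N : nat) (lam : N.-tuple nat) (y : nat -> K).

Let X (i : 'I_N) : mpoly N K := mpolyX K (mnm1 i).
Let Y (l : nat) : mpoly N K := mpolyC N (y l).

Lemma factorial_schur_poly_exists :
  exists q : mpoly N K, q * vandermonde_prod X == alternant lam X Y.
Proof.
have [q qE] := vandermonde_dvd_det X (fun j : 'I_N =>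
  \prod_(1 <= l < (tnth lam j + (N - j.+1)).+1) ('X + (Y l)%:P)).
exists q; apply/eqP; rewrite qE; congr (\det _).
apply/matrixP => i j; rewrite !mxE horner_prod.
by apply: eq_bigr => l _; rewrite hornerD hornerX hornerC.
Qed.

(* mpoly N K being an integral domain, the quotient is unique. *)
Definition factorial_schur_poly : mpoly N K :=
  xchoose factorial_schur_poly_exists.

Definition factorial_schur (x : 'I_N -> K) : K := meval x factorial_schur_poly.

Lemma factorial_schurM (x : 'I_N -> K) :
  factorial_schur x * vandermonde_prod x = alternant lam x y.
Proof.
have := congr1 (meval x) (eqP (xchooseP factorial_schur_poly_exists)).
rewrite -/factorial_schur_poly rmorphM /= -/(factorial_schur x).
have XE i : meval x (X i) = x i by rewrite /X mevalXU.
have -> : meval x (vandermonde_prod X) = vandermonde_prod x.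
  rewrite rmorph_prod; apply: eq_bigr => i _; rewrite rmorph_prod.
  by apply: eq_bigr => j _; rewrite rmorphB /= !XE.
move=> ->; rewrite /alternant -det_map_mx; congr (\det _).
apply/matrixP => i j; rewrite !mxE rmorph_prod.
by apply: eq_bigr => l _; rewrite rmorphD /= XE mevalC.
Qed.

Lemma factorial_schurE (x : 'I_N -> K) : injective x ->
  factorial_schur x = alternant lam x y / vandermonde_prod x.
Proof.
move=> xI; rewrite -factorial_schurM mulfK //.
apply/prodf_neq0 => i _; apply/prodf_neq0 => j ij.
by rewrite subr_eq0; apply: contraTneq ij => /xI ->; rewrite ltnn.
Qed.

End FactorialSchur.

(* Main.v *)
(* In the limit the weights become 1 + x/y, x/y, 1, 1, x/y, and 0 for two paths
   crossing at a vertex. In each row the positions of the paths above and below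
   then interlace, and the row contributes the branching weight of the factorial
   Schur polynomial. That the alternant satisfies the same branching rule is seen
   by row operations: with c the product of the x_1 + y_l over a <= l < b, the
   polynomial (x | y)^(b-1) - c (x | y)^(a-1) is x - x_1 times a sum over the
   interval [a, b). For the exchange of sum and limit, the configurations with
   a nonzero weight belong to a finite set independent of the parameters. *)

Require Import Defs.
From HB Require Import structures.
From mathcomp Require Import all_boot all_order all_algebra finmap.
From mathcomp Require Import all_classical all_reals topology normedtype sequences.
From mathcomp Require Import complex.
From mathcomp Require Import ring.
From mathcomp Require Import -(notations) mpoly.
Set Implicit Arguments.
Unset Strict Implicit.
Unset Printing Implicit Defensive.
Import Order.TTheory GRing.Theory Num.Theory.
Import numFieldNormedType.Exports.
Local Open Scope classical_set_scope.
Local Open Scope ring_scope.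

(** * Row-by-row partition functions *)

Section RowSum.
Variable A : comNzRingType.

(* Weights of the vertices of one row; the first argument is the index of the
   column, counted from 1, and the edges are ordered as in What. *)
Definition vertex_weights := nat -> bool -> bool -> bool -> bool -> A.

(* The sum over the configurations of a row whose bottom edges have the states
   [bot], [i] being the first column and [h] the state of its left edge; the
   states of the top edges are passed to [G]. *)
Fixpoint row_sum (f : vertex_weights) (i : nat) (h : bool) (bot : seq bool)
    (G : seq bool -> A) : A :=
  if bot is b :: bot' then
    \sum_(e : bool * bool)
      f i b h e.1 e.2 * row_sum f i.+1 e.2 bot' (fun top => G (e.1 :: top))
  else h%:R * G [::].

Lemma row_sum_cons f i h b bot G : row_sum f i h (b :: bot) G =
  (f i b h true true * row_sum f i.+1 true bot (fun top => G (true :: top))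
   + f i b h true false * row_sum f i.+1 false bot (fun top => G (true :: top)))
  + (f i b h false true * row_sum f i.+1 true bot (fun top => G (false :: top))
   + f i b h false false * row_sum f i.+1 false bot (fun top => G (false :: top))).
Proof.
rewrite /= -(pair_bigA _ (fun u v =>
  f i b h u v * row_sum f i.+1 v bot (fun top => G (u :: top)))) /=.
by rewrite !big_bool.
Qed.

Lemma eq_row_sum f i h bot G G' :
  G =1 G' -> row_sum f i h bot G = row_sum f i h bot G'.
Proof.
elim: bot i h G G' => [|b bot IH] i h G G' GG' /=; first by rewrite GG'.
by apply: eq_bigr => e _; congr (_ * _); apply: IH => top.
Qed.

Lemma row_sumZ f i h bot c G :
  c * row_sum f i h bot G = row_sum f i h bot (fun top => c * G top).
Proof.
elim: bot i h G => [|b bot IH] i h G /=; first by rewrite mulrCA.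
by rewrite mulr_sumr; apply: eq_bigr => e _; rewrite mulrCA IH.
Qed.

(** Transfer matrices: the tops of one row are the bottoms of the next. The base case forces v(i,N)
    = 0; the factor [h%:R] closing [row_sum] forces an occupied edge at the right end. *)
Fixpoint part_fun (n : nat) : ('I_n -> vertex_weights) -> seq bool -> A :=
  if n is n'.+1 then fun w bot =>
    row_sum (w ord0) 1 false bot (part_fun (fun j => w (lift ord0 j)))
  else fun _ bot => (~~ has id bot)%:R.

Fixpoint pos (i : nat) (s : seq bool) : seq nat :=
  if s is b :: s' then if b then i :: pos i.+1 s' else pos i.+1 s' else [::].

Lemma pos_geq i s : all (leq i) (pos i s).
Proof.
elim: s i => //= b s IH i; have H : all (leq i) (pos i.+1 s).
  by apply: sub_all (IH i.+1) => k /ltnW.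
by case: b => //=; rewrite leqnn.
Qed.

Lemma pos_iota (P : pred nat) i n :
  pos i [seq P l | l <- iota i n] = [seq l <- iota i n | P l].
Proof. by elim: n i => //= n IH i; rewrite IH. Qed.

Lemma pos_eq_nil i s : (size (pos i s) == 0%N) = ~~ has id s.
Proof. by elim: s i => //= b s IH i; case: b => //=. Qed.

Definition multilinear (V : lmodType A) (Phi : seq V -> A) :=
  forall p s a u v,
    Phi (p ++ (a *: u + v) :: s) = a * Phi (p ++ u :: s) + Phi (p ++ v :: s).

Lemma multilinear_cons (V : lmodType A) (Phi : seq V -> A) u :
  multilinear Phi -> multilinear (fun l => Phi (u :: l)).
Proof. by move=> lPhi p; apply: (lPhi (u :: p)). Qed.

Lemma multilinear0 (V : lmodType A) (Phi : seq V -> A) s :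
  multilinear Phi -> Phi (0 :: s) = 0.
Proof.
move=> lPhi; have := lPhi [::] s (-1) 0 0.
by rewrite /= scaler0 addr0 mulN1r addNr.
Qed.

Section FiveVertex.
Variables (x : A) (z : nat -> A).

(* The limits of the weights What, with [z] the inverse of [y]. *)
Definition five_vertex : vertex_weights := fun i i1 j1 i2 j2 =>
  match i1, j1, i2, j2 with
  | false, false, false, false => 1 + x * z i
  | true, false, true, false => x * z i
  | false, true, false, true => 1
  | true, false, false, true => 1
  | false, true, true, false => x * z i
  | _, _, _, _ => 0
  end.

Variables (V : lmodType A) (P : nat -> V).

(** All ways for a path entering [a, b) to leave it upwards: weight 1 before the exit column [n],
    [x * z n] there, and 1 + x z_l in the empty columns after it. *)
Definition span_sum (a b : nat) : V :=
  \sum_(a <= n < b) (x * z n * \prod_(n.+1 <= l < b) (1 + x * z l)) *: P n.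

(* The weight of a horizontal edge crossing an occupied column vanishes, so the
   path starting at [a] goes up strictly before the next occupied column [b]:
   the tops interlace with the bottoms, and each of them is summed over its own
   interval [a, b). *)
Lemma row_sum_five (i : nat) (bot : seq bool) (Phi : seq V -> A) :
    multilinear Phi ->
  let G top := Phi [seq P k | k <- pos i top] in
  row_sum (five_vertex) i true bot G = Phi (pairmap span_sum i (pos i bot)) /\
  row_sum (five_vertex) i false bot G =
    if pos i bot is a :: s then
      (\prod_(i <= l < a) (1 + x * z l)) * Phi (pairmap span_sum a s)
    else 0.
Proof.
elim: bot i Phi => [|b bot IH] i Phi lPhi G; first by rewrite /= mul1r mul0r.
rewrite !row_sum_cons.
have [IHt IHf] := IH i.+1 _ lPhi.
have [_ IHc] := IH i.+1 _ (multilinear_cons (P i) lPhi).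
have/= := pos_geq i.+1 bot.
have sii : span_sum i i = 0 by rewrite /span_sum big_geq.
have spanS a : (i < a)%N -> span_sum i a =
    (x * z i * \prod_(i.+1 <= l < a) (1 + x * z l)) *: P i + span_sum i.+1 a.
  by move=> ia; rewrite [LHS]big_ltn.
rewrite /G; case: b; rewrite /= !(mul0r, mul1r, add0r, addr0) IHt ?IHf IHc /=.
  (* A path running into an occupied column has weight 0; on the other side this is the empty
     interval [span_sum i i], a zero argument of [Phi]. *)
  rewrite sii multilinear0 // big_geq // mul1r.
  case: (pos i.+1 bot) => [|a s] /= => [_|/andP[ia _]].
    by rewrite mulr0 add0r.
  by rewrite mulrA (spanS _ ia) (lPhi [::]).
case: (pos i.+1 bot) => [|a s] /= => [_|/andP[ia _]].
  by rewrite !mulr0 add0r.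
split; last by rewrite [in RHS]big_ltn // mulrA.
by rewrite mulrA (spanS _ ia) (lPhi [::]).
Qed.
End FiveVertex.
End RowSum.

(** * Branching rule of the factorial alternant *)

Section FactorialAlternant.
Variables (A : comNzRingType) (z : nat -> A).

(** With z_l = 1/y_l this is (t | y)^(k-1) / (y_1 ... y_(k-1)): the index [k] is an element of
    S(lam), one more than the exponent in the alternant. *)
Definition falling (t : A) (k : nat) : A := \prod_(1 <= l < k) (1 + t * z l).

(** The sum telescopes, since (x - t) z_n = (1 + x z_n) - (1 + t z_n). *)
Lemma falling_telescope (x t : A) (a b : nat) : (0 < a)%N -> (a <= b)%N ->
  (x - t) * (\sum_(a <= n < b)
     z n * \prod_(n.+1 <= l < b) (1 + x * z l) * falling t n) =
  \prod_(a <= l < b) (1 + x * z l) * falling t a - falling t b.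
Proof.
move=> a0; elim: b => [|b IH]; first by rewrite leqn0 => /eqP a_eq0; rewrite a_eq0 in a0.
rewrite leq_eqVlt => /orP[/eqP<-|ab]; first by rewrite !big_geq // mulr0 mul1r subrr.
have ab' : (a <= b)%N by [].
have prodS n : (n <= b)%N ->
    \prod_(n <= l < b.+1) (1 + x * z l) = \prod_(n <= l < b) (1 + x * z l) * (1 + x * z b).
  by move=> nb; rewrite big_nat_recr.
have fallS : falling t b.+1 = falling t b * (1 + t * z b).
  by rewrite /falling big_nat_recr // (leq_trans a0).
rewrite fallS prodS // [\sum_(a <= n < b.+1) _]big_nat_recr //.
rewrite [\prod_(b.+1 <= _ < _) _]big_geq // mulr1 mulrDr.
rewrite (_ : \sum_(a <= n < b) _ = (1 + x * z b) * (\sum_(a <= n < b)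
     z n * \prod_(n.+1 <= l < b) (1 + x * z l) * falling t n)); last first.
  rewrite mulr_sumr; apply: eq_big_nat => n /andP[_ nb].
  by rewrite prodS //; ring.
by rewrite mulrCA IH //; ring.
Qed.

(* The last vector of [l] is the first row; for a sequence of the wrong size,
   the value 0 keeps the lemmas below unconditional. *)
Definition rows_det (m : nat) (l : seq 'rV[A]_m) : A :=
  if size l == m then \det (\matrix_(k < m) nth 0 l (rev_ord k)) else 0.

Lemma rows_det_multilinear m : multilinear (@rows_det m).
Proof.
move=> p s a u v; rewrite /rows_det !size_cat /=.
case: eqP => [sz|_]; last by rewrite mulr0 addr0.
have pm : (size p < m)%N by move: (leq_addr (size s) (size p).+1); rewrite addSnnS sz.
pose i0 := rev_ord (Ordinal pm).
have i0E : (m - i0.+1)%N = size p by rewrite -[LHS]/(nat_of_ord (rev_ord i0)) rev_ordK.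
rewrite -[X in _ = _ + X]mul1r; apply: (determinant_multilinear (i0 := i0)).
  by rewrite !rowK i0E !nth_cat ltnn subnn /= scale1r.
all: apply/row_matrixP => k; rewrite !row_rowsub !rowK !nth_cat.
all: case: ltngtP => // E; last by
  case/eqP: (neq_lift i0 k); apply: (can_inj (@rev_ordK m)); apply: val_inj;
  exact: etrans i0E (esym E).
all: by rewrite -subn_gt0 in E; case: (_ - _)%N E.
Qed.

Definition falling_row m (x : 'I_m -> A) (k : nat) : 'rV[A]_m :=
  \row_j falling (x j) k.

(* Subtracting from each row a multiple of the next one clears the first column
   but for its last entry, and makes [x' j - x ord0] a factor of column [j]. *)
Lemma rows_det_branching m (x : 'I_m.+1 -> A) (a : nat) (s : seq nat) :
    (0 < a)%N -> path leq a s ->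
  let x0 := x ord0 in let x' j := x (lift ord0 j) in
  \prod_(j < m) (x0 - x' j) *
    (falling x0 a * rows_det (pairmap (span_sum x0 z (falling_row x')) a s)) =
  x0 ^+ m * rows_det [seq falling_row x k | k <- a :: s].
Proof.
move=> a0 as_sorted x0 x'.
rewrite /rows_det size_pairmap /= size_map eqSS.
case: eqP => [sz|_]; last by rewrite !mulr0.
pose mu k := nth 0%N (a :: s) (m - k).
have mu_pos k : (0 < mu k)%N.
  have/allP : all (leq a) (a :: s) by rewrite /= leqnn order_path_min //; apply: leq_trans.
  by move=> ge_a; apply: leq_trans a0 (ge_a _ (mem_nth _ _)); rewrite /= sz ltnS leq_subr.
have mu_le k : (k < m)%N -> (mu k.+1 <= mu k)%N.
  move=> km; have/(pathP 0%N)/(_ (m - k.+1)%N) := as_sorted.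
  rewrite sz ltn_subrL (leq_ltn_trans _ km) // => /(_ isT).
  by rewrite /mu -(subnSK km).
pose c k : A := \prod_(mu k.+1 <= l < mu k) (1 + x0 * z l).
pose S t k := \sum_(mu k.+1 <= n < mu k)
     z n * \prod_(n.+1 <= l < mu k) (1 + x0 * z l) * falling t n.
(* Left multiplication by [U] subtracts [c k] times row k+1 from row k; being unitriangular, it
   preserves the determinant. *)
pose U : 'M[A]_m.+1 := 1%:M - \matrix_(k, k') (c k *+ (k' == k.+1 :> nat)).
have detU : \det U = 1.
  rewrite -det_tr det_trig.
    apply: big1 => k _; rewrite !mxE eqxx (_ : (k == k.+1 :> nat) = false) ?subr0 //.
    by rewrite eqn_leq ltnn andbF.
  apply/is_trig_mxP => i j ij; rewrite !mxE.
  have -> : (j == i) = false by apply/negbTE; rewrite eq_sym neq_ltn ij.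
  have -> : (i == j.+1 :> nat) = false.
    by apply/negbTE; rewrite neq_ltn ltnS (ltnW ij).
  by rewrite mulr0n mulr0n subr0.
set B := \matrix_(k < m.+1) _.
have BE k j : B k j = falling (x j) (mu k).
  rewrite mxE -map_cons (nth_map 0%N) ?mxE /= ?subSS //.
  by rewrite sz ltnS leq_subr.
have UBE k j : (U *m B) k j =
    if (k < m)%N then - ((x0 - x j) * S (x j) k) else falling (x j) (mu k).
  rewrite mulmxBl mul1mx [LHS]mxE BE [X in _ + X]mxE [X in _ - X]mxE.
  case: ltnP => km; last first.
    rewrite big1 ?subr0 // => k' _; rewrite mxE (_ : (k' == k.+1 :> nat) = false) ?mul0r //.
    by apply/negP => /eqP E; have := ltn_ord k'; rewrite E ltnS ltnNge km.
  have km' : (k.+1 < m.+1)%N by [].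
  rewrite (bigD1 (Ordinal km')) //= big1 ?addr0.
    by rewrite [X in X * _]mxE BE eqxx mulr1n falling_telescope ?mu_le // opprB.
  move=> k' /eqP k'k; rewrite mxE (_ : (k' == k.+1 :> nat) = false) ?mul0r //.
  by apply/negP => /eqP E; apply: k'k; apply: val_inj.
have <- : \det (U *m B) = \det B by rewrite det_mulmx detU mul1r.
have -> : \det (U *m B) = (U *m B) ord_max ord0 * cofactor (U *m B) ord_max ord0.
  rewrite (expand_det_col _ ord0) (bigD1 ord_max) //= big1 ?addr0 // => k kmax.
  rewrite UBE ifT ?subrr ?mul0r ?oppr0 ?mul0r //.
  by rewrite ltn_neqAle -ltnS ltn_ord andbT.
rewrite UBE ltnn /mu subnn /= mulrCA [RHS]mulrCA; congr (_ * _).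
(* The sign (-1)^m of the corner cofactor cancels the -1 drawn from each of the other m rows. *)
rewrite /cofactor /= addn0.
have -> : row' ord_max (col' ord0 (U *m B)) =
   (-1) *: \matrix_(k, j) ((x0 - x' j) * S (x' j) k).
  apply/matrixP => k j; rewrite [LHS]mxE [LHS]mxE UBE !mxE mulN1r.
  by rewrite lift_max ltn_ord.
rewrite detZ [X in _ = _ * X]mulrA -exprMn mulN1r opprK expr1n mul1r.
(* [x0 ^+ m] becomes a scalar on the matrix, matching the factor x in [span_sum], and the product of
   the x0 - x'_j a diagonal matrix. *)
rewrite -detZ -[\prod_(j < m) _]mul1r.
have -> : \prod_(j < m) (x0 - x' j) = \det (diag_mx (\row_j (x0 - x' j))).
  by rewrite det_diag; apply: eq_bigr => j _; rewrite mxE.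
rewrite mul1r mulrC -det_mulmx; congr (\det _).
apply/matrixP => k j; rewrite !mxE (bigD1 j) //= big1 ?addr0; last first.
  by move=> j' j'j; rewrite !mxE (negbTE j'j) mulr0.
rewrite !mxE eqxx mulr1n.
have km : (m - k.+1 < size s)%N.
  by rewrite sz ltn_subrL (leq_ltn_trans _ (ltn_ord k)).
rewrite (nth_pairmap 0%N) // summxE mulrC mulrCA; congr (_ * _).
have -> : nth 0%N s (m - k.+1) = mu k by rewrite /mu -(subnSK (ltn_ord k)).
rewrite mulr_sumr; apply: eq_bigr => l _.
by rewrite !mxE !mulrA.
Qed.

Lemma vandermonde_prod_recl m (x : 'I_m.+1 -> A) :
  vandermonde_prod x = \prod_(j < m) (x ord0 - x (lift ord0 j)) *
    vandermonde_prod (fun j => x (lift ord0 j)).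
Proof.
rewrite /vandermonde_prod big_ord_recl; congr (_ * _).
  by rewrite big_mkcond big_ord_recl /= mul1r.
apply: eq_bigr => i _; rewrite big_mkcond big_ord_recl /= mul1r [RHS]big_mkcond.
by apply: eq_bigr => j _.
Qed.

Lemma path_pos i s : if pos i s is a :: l then path leq a l else true.
Proof.
have : sorted leq (pos i s).
  elim: s i => //= b s IH i; case: b; rewrite /= ?IH //.
  rewrite path_sortedE ?IH ?andbT; last exact: leq_trans.
  by apply: sub_all (pos_geq i.+1 s) => k /ltnW.
by case: (pos i s).
Qed.

(** Induction on the rows: [row_sum_five], with [Phi] the determinant in the remaining variables,
    sums out the first row, and [rows_det_branching] absorbs the new Vandermonde factors. *)
Lemma part_fun_five m (x : 'I_m -> A) bot :
  part_fun (fun j => five_vertex (x j) z) bot * vandermonde_prod x =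
  \prod_(j < m) x j ^+ (m - j.+1) *
    rows_det [seq falling_row x k | k <- pos 1 bot].
Proof.
elim: m x bot => [|m IH] x bot.
  rewrite /vandermonde_prod !big_ord0 /= /rows_det size_map pos_eq_nil det_mx00.
  by rewrite mulr1 mul1r; case: (has _ _).
rewrite vandermonde_prod_recl /= mulrCA [_ * vandermonde_prod _]mulrC row_sumZ.
under eq_row_sum do rewrite mulrC IH.
rewrite -row_sumZ.
have [_ ->] := row_sum_five (x ord0) z (falling_row (fun j => x (lift ord0 j))) 1
  bot (@rows_det_multilinear m).
have := path_pos 1 bot; have := pos_geq 1 bot.
rewrite big_ord_recl subn1 /=.
case: (pos 1 bot) => [|a s] /= => [_ _|/andP[a0 _] as_sorted].
  by rewrite /rows_det /= !mulr0.
rewrite mulrCA (rows_det_branching x a0 as_sorted) mulrCA mulrA.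
by congr (_ * _ * _); apply: eq_bigr => j _; rewrite subSS.
Qed.
End FactorialAlternant.

(** * The five-vertex partition function is a factorial Schur polynomial *)

Lemma row_sum_rmorph (A B : comNzRingType) (phi : {rmorphism A -> B})
    (f : vertex_weights A) i h bot G :
  phi (row_sum f i h bot G) =
  row_sum (fun i i1 j1 i2 j2 => phi (f i i1 j1 i2 j2)) i h bot
    (fun top => phi (G top)).
Proof.
elim: bot i h G => [|b bot IH] i h G /=; first by rewrite rmorphM rmorph_nat.
by rewrite rmorph_sum; apply: eq_bigr => e _; rewrite rmorphM IH.
Qed.

Lemma eq_row_sumf (A : comNzRingType) (f g : vertex_weights A) i h bot G :
    (forall i i1 j1 i2 j2, f i i1 j1 i2 j2 = g i i1 j1 i2 j2) ->
  row_sum f i h bot G = row_sum g i h bot G.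
Proof.
move=> fg; elim: bot i h G => [|b bot IH] i h G //=.
by apply: eq_bigr => e _; rewrite fg IH.
Qed.

(** Serves to specialise an identity in indeterminates to arbitrary points x_i. *)
Lemma part_fun_rmorph (A B : comNzRingType) (phi : {rmorphism A -> B}) m
    (w : 'I_m -> vertex_weights A) (w' : 'I_m -> vertex_weights B) bot :
    (forall j i i1 j1 i2 j2, phi (w j i i1 j1 i2 j2) = w' j i i1 j1 i2 j2) ->
  phi (part_fun w bot) = part_fun w' bot.
Proof.
elim: m w w' bot => [|m IH] w w' bot ww' /=; first by rewrite rmorph_nat.
rewrite row_sum_rmorph (eq_row_sumf _ _ _ _ (ww' ord0)).
by apply: eq_row_sum => top; apply: IH => j *; apply: ww'.
Qed.

(** * The set S(lam) and the monomial in y *)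

Section Signature.
Variables (N : nat) (lam : N.-tuple nat).

Definition shifted_part (j : nat) : nat := (nth 0%N lam j + (N - j))%N.

Lemma in_positions l : (l \in positions lam) = (l \in mkseq shifted_part N).
Proof.
apply/imfsetP/mapP => /= [[j _ ->]|[j]].
  by exists (j : nat); rewrite ?mem_iota //= /shifted_part (tnth_nth 0%N).
rewrite mem_iota /= => jN ->; exists (Ordinal jN) => //.
by rewrite (tnth_nth 0%N).
Qed.

Lemma positions_gt0 l : l \in positions lam -> (0 < l)%N.
Proof.
rewrite in_positions => /mapP[j]; rewrite mem_iota => /= jN ->.
by rewrite /shifted_part ltn_addl // subn_gt0.
Qed.

Lemma signature_sorted : signature lam -> sorted ltn (rev (mkseq shifted_part N)).
Proof.
move=> /(sortedP 0%N) lamS; rewrite rev_sorted; apply/(sortedP 0%N) => i.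
rewrite size_mkseq => iN; rewrite !nth_mkseq ?(ltnW iN) //.
have := lamS i; rewrite size_tuple => /(_ iN) /= lamS_i.
by rewrite /shifted_part -(subnSK (ltnW iN)) /= addnS ltnS leq_add2r.
Qed.

Lemma filter_positions M : signature lam ->
    (forall l, l \in positions lam -> (l <= M)%N) ->
  [seq l <- iota 1 M | l \in positions lam] = rev (mkseq shifted_part N).
Proof.
move=> lamS leM; apply: (irr_sorted_eq ltn_trans ltnn).
- exact/sorted_filter/iota_ltn_sorted/ltn_trans.
- exact: signature_sorted.
move=> l; rewrite mem_filter mem_rev -in_positions mem_iota add1n ltnS.
by case: (boolP (l \in _)) => //= lP; rewrite positions_gt0 // leM.
Qed.

(** Each factor 1 + x z_l is (x + y_l) z_l, and the product of the z_l depends only on the part, so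
    it scales a column of the alternant. *)
Lemma rows_det_signature (A : comNzRingType) M (x : 'I_N -> A) (y z : nat -> A) :
    signature lam ->
    (forall l, l \in positions lam -> (l <= M)%N) ->
    (forall l, (0 < l)%N -> y l * z l = 1) ->
  rows_det [seq falling_row z x k |
              k <- pos 1 [seq l \in positions lam | l <- iota 1 M]] =
  (\prod_(j < N) \prod_(1 <= l < shifted_part j) z l) * alternant lam x y.
Proof.
move=> lamS leM yz; rewrite pos_iota filter_positions // /rows_det.
rewrite size_map size_rev size_mkseq eqxx -det_tr.
have -> : \prod_(j < N) \prod_(1 <= l < shifted_part j) z l =
    \det (diag_mx (\row_(j < N) \prod_(1 <= l < shifted_part j) z l)).
  by rewrite det_diag; apply: eq_bigr => j _; rewrite mxE.
rewrite mulrC -det_mulmx; congr (\det _); apply/matrixP => i j.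
rewrite !mxE (bigD1 j) //= big1 ?addr0; last first.
  by move=> k kj; rewrite !mxE (negbTE kj) mulr0.
rewrite !mxE eqxx mulr1n (nth_map 0%N) ?size_rev ?size_mkseq ?rev_ord_proof //.
rewrite nth_rev ?size_mkseq ?rev_ord_proof // subnSK // subKn ?nth_mkseq //; last exact: ltnW.
rewrite !mxE /falling /shifted_pow (tnth_nth 0%N).
have -> : (nth 0%N lam j + (N - j.+1)).+1 = shifted_part j by rewrite /shifted_part -addnS subnSK.
rewrite -big_split; apply: eq_big_nat => l /andP[l0 _].
by rewrite /= mulrDl yz // addrC.
Qed.

Lemma positions_aboveE i : signature lam ->
  positions_above lam i = count (fun k => (i < k)%N) (mkseq shifted_part N).
Proof.
move=> lamS; rewrite -size_filter /positions_above; apply: perm_size.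
apply: uniq_perm; first exact: fset_uniq.
  by rewrite filter_uniq // -rev_uniq (sorted_uniq ltn_trans ltnn) // signature_sorted.
by move=> k; rewrite mem_filter -in_positions !inE andbC.
Qed.

(** Double counting of the pairs 0 < i < k with k in S(lam). *)
Lemma fsbig_positions_above (K : fieldType) (y : nat -> K) : signature lam ->
  \big[*%R/1]_(i \in [set i | (0 < i)%N]) y i ^+ positions_above lam i =
  \prod_(j < N) \prod_(1 <= l < shifted_part j) y l.
Proof.
move=> lamS.
pose M := (\sum_(j < N) shifted_part j)%N.
have leM j : (j < N)%N -> (shifted_part j <= M)%N.
  by move=> jN; rewrite /M (bigD1 (Ordinal jN)) //= leq_addr.
rewrite (fsbigE (iota 1 M) _ (iota_uniq 1 M)) /=; first last.
- move=> i /= i0; rewrite mem_iota i0 add1n ltnS -ltnNge => Mi.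
  rewrite positions_aboveE // -size_filter (_ : seq.filter _ _ = [::]) //.
  apply/eqP; rewrite -[_ == _]negbK -has_filter; apply/hasPn => _ /mapP[j + ->].
  by rewrite mem_iota -leqNgt => /= /leM jM; apply: leq_trans jM (ltnW Mi).
- by move=> i /=; rewrite mem_iota => /andP[].
transitivity (\prod_(l <- iota 1 M) \prod_(k <- mkseq shifted_part N | (l < k)%N) y l).
  rewrite big_seq_cond [RHS]big_seq; apply: eq_big => [l|l _].
    by rewrite andb_idr // mem_iota => /andP[l0 _]; apply: mem_set.
  by rewrite positions_aboveE // big_const_seq -Monoid.iteropE.
rewrite (exchange_big_dep predT) //= big_map -{1}[N]subn0 big_mkord.
apply: eq_bigr => j _.
have -> : iota 1 M = index_iota 1 M.+1 by rewrite /index_iota subn1.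
by rewrite [RHS](big_nat_widen _ _ M.+1) // (leqW (leM _ _)).
Qed.

Section Field.
Variables (K : fieldType) (x : 'I_N -> K) (y : nat -> K).
Hypotheses (lamS : signature lam) (y_neq0 : forall l, (0 < l)%N -> y l != 0).

Lemma part_fun_factorial_schur M :
    (forall l, l \in positions lam -> (l <= M)%N) ->
  part_fun (fun j => five_vertex (x j) (fun l => (y l)^-1))
    [seq l \in positions lam | l <- iota 1 M] =
  \prod_(j < N) x j ^+ (N - j.+1) *
    (\prod_(j < N) \prod_(1 <= l < shifted_part j) (y l)^-1) * factorial_schur lam y x.
Proof.
move=> leM.
(* The points may coincide, so the Vandermonde product is cancelled in the ring
   of polynomials. *)
pose X (i : 'I_N) : mpoly N K := mpolyX K (mnm1 i).
pose z (l : nat) : mpoly N K := mpolyC N (y l)^-1.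
pose bot := [seq l \in positions lam | l <- iota 1 M].
have XE i : meval x (X i) = x i by rewrite /X mevalXU.
have Xdet_neq0 : vandermonde_prod X != 0.
  apply/prodf_neq0 => i _; apply/prodf_neq0 => j ij; rewrite subr_eq0.
  apply: contraTneq ij => /(congr1 (mcoeff (mnm1 i)))/eqP.
  by rewrite !mcoeffXU eqxx [j == i]eq_sym; case: (i =P j) => [->|_]; rewrite ?ltnn // oner_eq0.
have : part_fun (fun j => five_vertex (X j) z) bot =
    \prod_(j < N) X j ^+ (N - j.+1) *
      (\prod_(j < N) \prod_(1 <= l < shifted_part j) z l) * factorial_schur_poly lam y.
  apply: (mulIf Xdet_neq0); rewrite part_fun_five.
  rewrite (@rows_det_signature _ _ _ (fun l => mpolyC N (y l))) //; last first.
    by move=> l l0; rewrite -mpolyCM mulfV ?y_neq0.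
  by rewrite -!mulrA (eqP (xchooseP (factorial_schur_poly_exists lam y))).
move=> /(congr1 (meval x)); rewrite !rmorphM /= -/(factorial_schur lam y x) !rmorph_prod.
rewrite (part_fun_rmorph (w' := fun j => five_vertex (x j) (fun l => (y l)^-1))).
  move=> ->; congr (_ * _ * _); apply: eq_bigr => j _.
    by rewrite rmorphXn /= XE.
  by rewrite rmorph_prod; apply: eq_bigr => l _; rewrite /= mevalC.
move=> j i [] [] [] [] /=; rewrite ?rmorphD ?rmorphM ?rmorph1 ?rmorph0 /= ?XE ?mevalC //.
Qed.
End Field.
End Signature.

(** * Expansion of F over a finite grid *)

Lemma big_tuple_cons (A : nmodType) (T : finType) n (F : n.+1.-tuple T -> A) :
  \sum_(t : n.+1.-tuple T) F t =
  \sum_(a : T) \sum_(t : n.-tuple T) F [tuple of a :: t].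
Proof.
rewrite pair_bigA /= (reindex (fun p : T * n.-tuple T => [tuple of p.1 :: p.2])) //=.
exists (fun t : n.+1.-tuple T => (thead t, [tuple of behead t])) => [[a t]|t] _ /=.
  by rewrite theadE; congr pair; apply: val_inj.
by rewrite [RHS]tuple_eta.
Qed.

Lemma big_tuple_nil (A : nmodType) (T : finType) (F : 0.-tuple T -> A) :
  \sum_(t : 0.-tuple T) F t = F [tuple].
Proof. by rewrite (big_pred1 [tuple]) // => t; rewrite [t]tuple0; apply/esym/eqP. Qed.

(* Cell [k] of a row lists the states of the edges above and to the right of
   the vertex in column [k + 1]; past the end of the row there is no vertical
   edge and every horizontal edge is occupied. *)
Definition cell (row : seq (bool * bool)) (k : nat) : bool * bool :=
  nth (false, true) row k.

Definition hstate (h : bool) (row : seq (bool * bool)) (k : nat) : bool :=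
  if k is k'.+1 then (cell row k').2 else h.

Lemma hstate_cons h e row k : hstate h (e :: row) k.+1 = hstate e.2 row k.
Proof. by case: k. Qed.

Section Expansion.
Variable A : comNzRingType.

Lemma row_sumE (f : vertex_weights A) i h n bot G : size bot = n ->
  row_sum f i h bot G = \sum_(row : n.-tuple (bool * bool))
    (\prod_(k < n) f (i + k)%N (nth false bot k)
       (hstate h row k) (cell row k).1 (hstate h row k.+1)) *
    (hstate h row n)%:R * G [seq (cell row k).1 | k <- iota 0 n].
Proof.
elim: n i h bot G => [|n IH] i h [|b bot] //= G => [_|[sz]].
  by rewrite big_tuple_nil big_ord0 mul1r.
rewrite big_tuple_cons; apply: eq_bigr => e _.
rewrite (IH _ _ _ _ sz) mulr_sumr; apply: eq_bigr => row _.
have hS := hstate_cons h e row n; rewrite /= in hS.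
rewrite big_ord_recl addn0 /= hS !mulrA; congr (_ * _ * _ * G (_ :: _)).
  by apply: eq_bigr => k _; rewrite addSnnS; case: k => [[|k] ?].
by rewrite (iotaDl 1 0) -map_comp; apply: eq_map.
Qed.

Section Grid.
Variables (N M : nat).
Implicit Type t : N.-tuple (M.-tuple (bool * bool)).

Definition vstate (bot : seq bool) t (k : nat) (j : 'I_N.+1) : bool :=
  if unlift ord0 j is Some j' then (cell (tnth t j') k).1 else nth false bot k.

(** The boundary condition left to impose: the bottom and left ones are built into [vstate bot] and
    [hstate false], and the right one is a factor of the summand. *)
Definition grid_valid bot t : bool :=
  ~~ has id [seq vstate bot t k ord_max | k <- iota 0 M].

Lemma vstate0 bot t k : vstate bot t k ord0 = nth false bot k.
Proof. by rewrite /vstate unlift_none. Qed.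

Lemma vstateS bot t k j : vstate bot t k (lift ord0 j) = (cell (tnth t j) k).1.
Proof. by rewrite /vstate liftK. Qed.
End Grid.

Lemma vstate_cons N M bot row (t : N.-tuple (M.-tuple (bool * bool))) k j :
  vstate bot [tuple of row :: t] k (lift ord0 j) =
  vstate [seq (cell row k).1 | k <- iota 0 M] t k j.
Proof.
rewrite vstateS; case: (unliftP ord0 j) => [j' ->|->].
  by rewrite vstateS tnthS.
rewrite vstate0 tnth0; have [kM|Mk] := ltnP k M; first by rewrite nth_mkseq.
by rewrite nth_default ?size_mkseq // /cell nth_default // size_tuple.
Qed.

Lemma part_funE N M (w : 'I_N -> vertex_weights A) bot : size bot = M ->
  part_fun w bot =
  \sum_(t : N.-tuple (M.-tuple (bool * bool)) | grid_valid bot t) \prod_(j < N)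
    ((\prod_(k < M) w j k.+1
        (vstate bot t k (widen_ord (leqnSn N) j)) (hstate false (tnth t j) k)
        (vstate bot t k (lift ord0 j)) (hstate false (tnth t j) k.+1))
     * (hstate false (tnth t j) M)%:R).
Proof.
move=> sz; rewrite big_mkcond; elim: N w bot sz => [|N IH] w bot sz.
  rewrite big_tuple_nil big_ord0 /grid_valid /=.
  rewrite (_ : map _ _ = bot); first by case: has.
  rewrite -[RHS](mkseq_nth false) sz; apply: eq_map => k.
  by rewrite (_ : ord_max = ord0) ?vstate0 //; apply: val_inj.
rewrite /= (row_sumE _ _ _ _ sz) big_tuple_cons; apply: eq_bigr => row _.
rewrite IH ?size_map ?size_iota // mulr_sumr; apply: eq_bigr => t _.
have -> : grid_valid bot [tuple of row :: t] =
    grid_valid [seq (cell row k).1 | k <- iota 0 M] t.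
  rewrite /grid_valid; congr (~~ has _ _); apply: eq_map => k.
  by rewrite -(vstate_cons bot row t); congr vstate; apply: val_inj.
case: ifP => _; last by rewrite mulr0.
rewrite big_ord_recl tnth0; congr (_ * _ * _).
  apply: eq_bigr => k _; rewrite vstateS tnth0 add1n.
  by rewrite (_ : widen_ord _ _ = ord0) ?vstate0 //; apply: val_inj.
apply: eq_bigr => j _; rewrite tnthS; congr (_ * _); apply: eq_bigr => k _.
rewrite vstate_cons (_ : widen_ord _ _ = lift ord0 (widen_ord (leqnSn N) j)) ?vstate_cons //.
exact: val_inj.
Qed.
End Expansion.

(** * Finite support of the sum defining F *)

Section PartitionFunction.
Variables (K : numFieldType) (N : nat) (lam : N.-tuple nat).
Variables (x : 'I_N -> K) (y : nat -> K) (r : 'I_N -> K) (s : nat -> K).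
Variable M : nat.
Hypothesis leM : forall l, l \in positions lam -> (l <= M)%N.

Local Notation grid := (N.-tuple (M.-tuple (bool * bool))).
Let bot : seq bool := [seq l \in positions lam | l <- iota 1 M].

Let column_weight (c : configuration N) (i : nat) : K := \prod_(j < N)
  What (c.1 i (widen_ord (leqnSn N) j)) (c.2 i j)
       (c.1 i (lift ord0 j)) (c.2 i.+1 j) (x j) (y i.+1) (r j) (s i.+1).

Lemma weight_near (c : configuration N) v :
    (\forall n \near \oo, \prod_(0 <= i < n) column_weight c i = v) ->
  weight x y r s c = v.
Proof. exact: lim_near_cst. Qed.

Definition grid_configuration (t : grid) : configuration N :=
  (fun i j => vstate bot t i j, fun i j => hstate false (tnth t j) i).

Lemma nth_bot i : nth false bot i = (i.+1 \in positions lam).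
Proof.
have [iM|Mi] := ltnP i M.
  by rewrite (nth_map 0%N) ?size_iota // nth_iota.
rewrite nth_default ?size_map ?size_iota //; apply/esym/negP => /leM.
by rewrite leqNgt ltnS Mi.
Qed.

Lemma cell_out (t : grid) i j : (M <= i)%N -> cell (tnth t j) i = (false, true).
Proof. by move=> Mi; rewrite /cell nth_default // size_tuple. Qed.

Lemma vstate_out (t : grid) i j : (M <= i)%N -> vstate bot t i j = false.
Proof.
move=> Mi; case: (unliftP ord0 j) => [j' ->|->].
  by rewrite vstateS cell_out.
by rewrite vstate0 nth_default // size_map size_iota.
Qed.

Lemma hstate_out (t : grid) i j : (M < i)%N -> hstate false (tnth t j) i = true.
Proof. by case: i => // i Mi; rewrite /= cell_out. Qed.

Lemma weight_grid (t : grid) :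
  weight x y r s (grid_configuration t) = \prod_(j < N)
    ((\prod_(k < M) What
        (vstate bot t k (widen_ord (leqnSn N) j)) (hstate false (tnth t j) k)
        (vstate bot t k (lift ord0 j)) (hstate false (tnth t j) k.+1)
        (x j) (y k.+1) (r j) (s k.+1))
     * (hstate false (tnth t j) M)%:R).
Proof.
apply: weight_near; exists M.+1 => // n /= Mn.
rewrite (big_cat_nat (leq0n M) (ltnW Mn)) /= big_split /=; congr (_ * _).
  by rewrite big_mkord exchange_big.
(* Column [M], counted from 0, has no vertical edge and its right edges are occupied, so each weight
   there is 1 or 0 according to the left edge: this is the factor [(hstate ...)%:R]. All later
   weights are 1. *)
rewrite big_ltn // -[RHS]mulr1; congr (_ * _).
  apply: eq_bigr => j _.
  by rewrite /= !vstate_out // cell_out //; case: hstate.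
rewrite big_nat big1 // => i /andP[Mi _]; apply: big1 => j _ /=.
by rewrite !vstate_out ?hstate_out ?cell_out // ltnW.
Qed.

Lemma grid_configuration_inj : injective grid_configuration.
Proof.
move=> t u [vE hE]; apply: eq_from_tnth => j; apply: val_inj.
apply: (@eq_from_nth _ (false, true)); first by rewrite !size_tuple.
move=> i _; rewrite [LHS]surjective_pairing [RHS]surjective_pairing; congr pair.
  by have := congr1 (fun v => v i (lift ord0 j)) vE; rewrite !vstateS.
exact: (congr1 (fun h => h i.+1 j) hE).
Qed.

Lemma grid_boundary (t : grid) : grid_valid bot t ->
  boundary lam (grid_configuration t).
Proof.
move=> /hasPn tV; split => //= [i|i|].
- by rewrite vstate0 nth_bot.
- have [iM|Mi] := ltnP i M; last exact: vstate_out.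
  by apply/negbTE/tV/map_f; rewrite mem_iota.
- by exists M.+1 => // i /= Mi j; apply: hstate_out.
Qed.

Lemma What_neq0 i1 j1 i2 j2 a b c d : What i1 j1 i2 j2 a b c d != 0 :> K ->
  (i1 + j1 = i2 + j2)%N.
Proof. by case: i1 j1 i2 j2 => [] [] [] [] //=; rewrite eqxx. Qed.

(* Paths are conserved and none enters beyond column [M], so the number of
   occupied horizontal edges does not change there; far away it is [N]. *)
Lemma boundary_grid (c : configuration N) :
    boundary lam c -> weight x y r s c != 0 ->
  exists2 t : grid, grid_valid bot t & c = grid_configuration t.
Proof.
case: c => v h [/= c0 cN cl [L _ cr]] wc.
(* A zero column kills all later partial products, hence the limit. *)
have col_neq0 i : column_weight (v, h) i != 0.
  apply: contra wc => /eqP ci; apply/eqP/weight_near; exists i.+1 => // n /= n_gt.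
  by rewrite (big_cat_nat (leq0n i) (ltnW n_gt)) //= [X in _ * X]big_ltn // ci mul0r mulr0.
have cons i j : (v i (widen_ord (leqnSn N) j) + h i j =
    v i (lift ord0 j) + h i.+1 j)%N.
  have /prodf_neq0/(_ j isT) := col_neq0 i; exact: What_neq0.
have flux i : (v i ord0 + \sum_(j < N) h i j = \sum_(j < N) h i.+1 j)%N.
  have : (\sum_(j < N) (v i (widen_ord (leqnSn N) j) + h i j) =
      \sum_(j < N) (v i (lift ord0 j) + h i.+1 j))%N by apply: eq_bigr.
  rewrite !big_split /= => E.
  have E' : (v i ord0 + \sum_(j < N) v i (lift ord0 j) =
      \sum_(j < N) v i (widen_ord (leqnSn N) j))%N.
    transitivity (\sum_(j < N.+1) v i j)%N; first by rewrite big_ord_recl.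
    by rewrite big_ord_recr /= cN addn0.
  apply: (@addnI (\sum_(j < N) v i (lift ord0 j))%N).
  by rewrite addnA [(_ + v i ord0)%N]addnC E'.
have c0_out i : (M <= i)%N -> v i ord0 = false.
  by move=> Mi; rewrite c0; apply/negP => /leM; rewrite ltnNge Mi.
have hfull i j : (M <= i)%N -> h i j = true.
  move=> Mi.
  have total n : (\sum_(j < N) h i j = \sum_(j < N) h (i + n)%N j)%N.
    elim: n => [|n ->]; first by rewrite addn0.
    by rewrite addnS -flux c0_out // (leq_trans Mi) // leq_addr.
  have : (\sum_(j < N) (h i j + ~~ h i j) = N)%N.
    by rewrite -[RHS]card_ord -sum1_card; apply: eq_bigr => k _; case: (h i k).
  have -> : (\sum_(j < N) (h i j + ~~ h i j) = N + \sum_(j < N) ~~ h i j)%N.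
    rewrite big_split /= (total L); congr (_ + _)%N.
    rewrite -[RHS]card_ord -sum1_card; apply: eq_bigr => k _.
    by rewrite (cr _ (leq_addl i L)).
  move=> /(congr1 (subn^~ N)); rewrite addKn subnn => /eqP.
  by rewrite sum_nat_eq0 => /forallP/(_ j); case: (h i j).
(* Between two full columns of horizontal edges, conservation keeps the vertical state the same at
   all heights, and it is empty at the bottom. *)
have vempty i j : (M <= i)%N -> v i j = false.
  move=> Mi; case: j => j; elim: j => [|j IH] jN.
    by rewrite -(c0_out _ Mi); congr (v i _); apply: val_inj.
  have jN' : (j < N)%N by [].
  have := cons i (Ordinal jN'); rewrite !hfull ?(leqW Mi) // => /addIn.
  rewrite (_ : widen_ord _ _ = Ordinal (ltnW jN)) ?IH; last exact: val_inj.
  rewrite (_ : lift _ _ = Ordinal jN); last exact: val_inj.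
  by case: (v i _).
pose t : grid := [tuple [tuple (v k (lift ord0 j), h k.+1 j) | k < M] | j < N].
have cellE j k : cell (tnth t j) k = (v k (lift ord0 j), h k.+1 j).
  have [kM|Mk] := ltnP k M; last by rewrite cell_out // hfull ?vempty // leqW.
  by rewrite tnth_mktuple -[k]/(nat_of_ord (Ordinal kM)) /cell -tnth_nth tnth_mktuple.
have vE k j : vstate bot t k j = v k j.
  case: (unliftP ord0 j) => [j' ->|->]; first by rewrite vstateS cellE.
  by rewrite vstate0 nth_bot c0.
exists t.
  by apply/hasPn => _ /mapP[k _ ->]; rewrite vE cN.
congr pair; apply/funext => k; apply/funext => j; first by rewrite -vE.
by case: k => [|k]; [exact: cl|rewrite /= cellE].
Qed.

(** The valid grid configurations lie in [boundary lam] and include all those of nonzero weight,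
    whatever the parameters; so [F] is a finite expression in the weights. *)
Theorem F_part_fun :
  F lam x y r s = part_fun (fun j i i1 j1 i2 j2 => What i1 j1 i2 j2 (x j) (y i) (r j) (s i)) bot.
Proof.
pose e := [seq grid_configuration t | t <- index_enum {: grid} & grid_valid bot t].
rewrite /F (fsbigE e).
- rewrite big_rmcond_in; last first.
    by move=> _ /mapP[t + ->]; rewrite mem_filter => /andP[/grid_boundary/mem_set -> _].
  rewrite big_map big_filter (@part_funE _ _ M) ?size_map ?size_iota //.
  by apply: eq_bigr => t _; rewrite weight_grid.
- by rewrite map_inj_uniq ?filter_uniq ?index_enum_uniq //; apply: grid_configuration_inj.
- by move=> _ /mapP[t + ->]; rewrite mem_filter => /andP[/grid_boundary].
- move=> c bc; apply: contraNeq => /(boundary_grid bc)[t tV ->].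
  by apply: map_f; rewrite mem_filter tV mem_index_enum.
Qed.
End PartitionFunction.

(** * The limit *)

(* With [u = s^2] and [q = r^-2], the rescaled weight What is this polynomial
   divided by [u * x + y]. *)
Definition rescaled_num (K : comNzRingType) (x y u q : K) (i1 j1 i2 j2 : bool) : K :=
  match i1, j1, i2, j2 with
  | false, false, false, false => x + y
  | true, true, true, true => - (q * y + u * x)
  | true, false, true, false => x + q * y
  | false, true, false, true => u * x + y
  | true, false, false, true => y * (1 - q)
  | false, true, true, false => x * (1 - u)
  | _, _, _, _ => 0
  end.

(** The substitution turns y - x into -(u x + y) / (u x y), whose factor u x y clears the negative
    powers of s; the result makes sense at u = q = 0. *)
Lemma What_rescaled (K : numFieldType) (x y s r : K) (i1 j1 i2 j2 : bool) :
    x != 0 -> y != 0 -> s != 0 -> s ^+ 2 * x + y != 0 ->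
  What i1 j1 i2 j2 (s ^- 2 * x^-1) (- y^-1) r s =
  rescaled_num x y (s ^+ 2) (r ^- 2) i1 j1 i2 j2 / (s ^+ 2 * x + y).
Proof.
move=> x0 y0 s0; have : s ^+ 2 != 0 by rewrite expf_neq0.
rewrite /What; move: (s ^+ 2) (r ^- 2) => u q u0 d0.
have -> : - y^-1 - u^-1 * x^-1 = - (u * x + y) / (u * x * y).
  by field; rewrite x0 y0 u0.
case: i1 j1 i2 j2 => [] [] [] [] /=; try by rewrite mul0r.
all: by field; rewrite ?oppr_eq0 ?x0 ?y0 ?u0 ?d0.
Qed.

Section Limit.
Variables (K : numFieldType) (T : Type) (FF : set_system T).
Hypothesis filterF : Filter FF.

(** Finite sums and products preserve limits. The bound [i <= k] is carried along because
    convergence of the weights is known only in columns counted from 1, where y is nonzero. *)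
Lemma row_sum_cvg (f : T -> vertex_weights K) (f' : vertex_weights K)
    i h bot (G : T -> seq bool -> K) (G' : seq bool -> K) :
    (forall k i1 j1 i2 j2, (i <= k)%N ->
       f p k i1 j1 i2 j2 @[p --> FF] --> f' k i1 j1 i2 j2) ->
    (forall top, G p top @[p --> FF] --> G' top) ->
  row_sum (f p) i h bot (G p) @[p --> FF] --> row_sum f' i h bot G'.
Proof.
elim: bot i h G G' => [|b bot IH] i h G G' ff' GG'.
  by apply: cvgM; [exact: cvg_cst|exact: GG'].
under eq_fun do rewrite row_sum_cons.
rewrite row_sum_cons.
apply: cvgD; apply: cvgD; apply: cvgM; (exact: ff') ||
  by apply: IH => [k *|top]; [apply: ff'; exact: ltnW|exact: GG'].
Qed.

Lemma part_fun_cvg m (w : T -> 'I_m -> vertex_weights K)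
    (w' : 'I_m -> vertex_weights K) bot :
    (forall j k i1 j1 i2 j2, (0 < k)%N ->
       w p j k i1 j1 i2 j2 @[p --> FF] --> w' j k i1 j1 i2 j2) ->
  part_fun (w p) bot @[p --> FF] --> part_fun w' bot.
Proof.
elim: m w w' bot => [|m IH] w w' bot ww' /=; first exact: cvg_cst.
apply: row_sum_cvg => [k *|top]; first exact: ww'.
by apply: (IH (fun p j => w p (lift ord0 j))) => j *; apply: ww'.
Qed.

(** The limit is the value at u = q = 0 of a quotient whose denominator tends to y. *)
Lemma What_cvg (s r : T -> K) (x y : K) (z : nat -> K) (i : nat) (i1 j1 i2 j2 : bool) :
    x != 0 -> y != 0 -> z i = y^-1 ->
    (\forall p \near FF, s p != 0) -> s p @[p --> FF] --> 0 ->
    (r p)^-1 @[p --> FF] --> 0 ->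
  What i1 j1 i2 j2 (s p ^- 2 * x^-1) (- y^-1) (r p) (s p) @[p --> FF] -->
  five_vertex x z i i1 j1 i2 j2.
Proof.
move=> x0 y0 zE s_neq0 s_cvg r_cvg.
have u_cvg : s p ^+ 2 @[p --> FF] --> 0.
  by have := cvgM s_cvg s_cvg; rewrite mulr0; apply.
have q_cvg : r p ^- 2 @[p --> FF] --> 0.
  under eq_fun do rewrite -exprVn.
  by have := cvgM r_cvg r_cvg; rewrite mulr0; apply.
have ux_cvg : s p ^+ 2 * x @[p --> FF] --> 0.
  by have := cvgM u_cvg (cvg_cst x (F := FF)); rewrite mul0r; apply.
have qy_cvg : r p ^- 2 * y @[p --> FF] --> 0.
  by have := cvgM q_cvg (cvg_cst y (F := FF)); rewrite mul0r; apply.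
have d_cvg : s p ^+ 2 * x + y @[p --> FF] --> y.
  by have := cvgD ux_cvg (cvg_cst y (F := FF)); rewrite add0r; apply.
have d_neq0 : \forall p \near FF, s p ^+ 2 * x + y != 0.
  by apply: cvgr_neq0 d_cvg _.
have num_cvg : rescaled_num x y (s p ^+ 2) (r p ^- 2) i1 j1 i2 j2 @[p --> FF] -->
    rescaled_num x y 0 0 i1 j1 i2 j2.
  case: i1 j1 i2 j2 => [] [] [] [] /=; try exact: cvg_cst.
  - by have := cvgN (cvgD qy_cvg ux_cvg); rewrite !mul0r; apply.
  - by have := cvgD (cvg_cst x (F := FF)) qy_cvg; rewrite mul0r; apply.
  - by have := cvgM (cvg_cst y (F := FF)) (cvgB (cvg_cst (1 : K) (F := FF)) q_cvg); apply.
  - by have := cvgM (cvg_cst x (F := FF)) (cvgB (cvg_cst (1 : K) (F := FF)) u_cvg); apply.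
  - by rewrite mul0r add0r.
have -> : five_vertex x z i i1 j1 i2 j2 = rescaled_num x y 0 0 i1 j1 i2 j2 / y.
  by rewrite /five_vertex zE; clear num_cvg; case: i1 j1 i2 j2 => [] [] [] [] /=; field.
have quot_cvg := cvgM num_cvg (cvgV y0 d_cvg).
(* The quotient form holds only eventually, once s and u x + y are nonzero. *)
refine (cvg_trans (near_eq_cvg _) (quot_cvg filterF filterF)).
near=> p => /=; rewrite What_rescaled //.
  by near: p; exact: s_neq0.
by near: p; exact: d_neq0.
Unshelve. all: by end_near.
Qed.
End Limit.

Lemma realC_inv_cvg0 (R : realType) :
  (r%:C%C : Cplx R)^-1 @[r --> pinfty_nbhs R] --> (0 : Cplx R).
Proof.
(* A positive element of [R[i]] is real, so the tolerance is a real [a], with threshold [a^-1]. *)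
apply/cvgr0Pnorm_lt => -[a b]; rewrite ltcE /= => /andP[/eqP-> a0].
exists a^-1; split; first by rewrite num_real.
move=> r ar; have r0 : 0 < r by apply: lt_trans ar; rewrite invr_gt0.
rewrite -fmorphV ger0_norm ?ltcR ?lecR ?invr_ge0 ?ltW //.
by rewrite invf_plt ?posrE.
Qed.

Theorem proposition4p4 (R : realType) (N : nat) (lam : N.-tuple nat)
    (x : 'I_N -> Cplx R) (y : nat -> Cplx R)
    (hlam : signature lam)
    (hx : forall j, x j != 0)
    (hy : forall i, (0 < i)%N -> y i != 0) :
  F lam (fun j => p.1 ^- 2 * (x j)^-1) (fun i => - (y i)^-1)
        (fun=> (p.2)%:C%C) (fun=> p.1)
    @[p --> filter_prod (0 : Cplx R)^' (pinfty_nbhs R)]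
  --> (\prod_(j < N) x j ^+ (N - j.+1)
       / (\big[*%R/1]_(i \in [set i | (0 < i)%N]) y i ^+ positions_above lam i)
       * factorial_schur lam y x : Cplx R).
Proof.
pose M := (\sum_(j < N) shifted_part lam j)%N.
have leM l : l \in positions lam -> (l <= M)%N.
  rewrite in_positions => /mapP[j + ->]; rewrite mem_iota => /= jN.
  by rewrite /M (bigD1 (Ordinal jN)) //= leq_addr.
under eq_fun do rewrite (F_part_fun _ _ _ _ leM).
rewrite fsbig_positions_above //.
have -> : (\prod_(j < N) \prod_(1 <= l < shifted_part lam j) y l)^-1 =
    \prod_(j < N) \prod_(1 <= l < shifted_part lam j) (y l)^-1.
  by rewrite -prodfV; apply: eq_bigr => j _; rewrite prodfV.
rewrite -(part_fun_factorial_schur _ hlam hy leM).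
apply: part_fun_cvg => j k i1 j1 i2 j2 k0.
apply: What_cvg => //; first exact: hy.
(* The punctured filter gives s != 0 near the limit; forgetting the puncture gives s -> 0. *)
- exact: (cvg_fst (nbhs_dnbhs_neq _)).
- exact: cvg_trans (cvg_fst (F := (0 : Cplx R)^')) (cvg_within _).
- exact: cvg_comp cvg_snd (@realC_inv_cvg0 R).
Qed.
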